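(* (i) For every constant $K>0$ there are constants $C,\gamma,n_0>0$ such that the following holds for every $n\ge n_0$, every $\Delta\ge 1$, every $\Delta$-regular graph $G$ on vertex set $[n]$, and every $T\le Kn$. There is an online algorithm such that, when $T$ edges $e_1,\ldots,e_T$ sampled independently and uniformly at random from $E(G)$ arrive online, with probability at least $1-n^{-\gamma}$, $$\max_{t\le T}\|d_t\|_\infty\le C(\log n)^{1/3}.$$ (ii) Further, for every constants $K,c>0$ there are constants $C,\gamma,n_0>0$ such that, if additionally $\Delta\ge c(\log n)^3$ (and $n\ge n_0$, $T\le Kn$), the algorithm satisfies, with probability at least $1-n^{-\gamma}$, $$\max_{t\le T}\|d_t\|_\infty\le C\Big(\Big(\frac{\log n}{\log\Delta}\Big)^{1/3}+\log\log n\Big).$$ Both bounds hold in the edge-weighted setting, where the request at time $t$ is the edge $e_t$ with a weight $w_t\in[0,1]$, and in fact the weights $w_t$ may be chosen by an adaptive adversary based on the previous samples $e_1,\ldots,e_{t-1}$.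
   Context: Online carpooling: the discrepancy vector starts at $d_0=0\in\mathbb{R}^n$. At time $t$ the request, an edge $e_t=\{i_t,j_t\}$ together with its weight $w_t$ ($w_t=1$ in the unweighted setting), is revealed to the algorithm, which must immediately and irrevocably choose a sign $\epsilon_t\in\{-1,1\}$ (an orientation of the edge) depending only on what has been revealed so far; then $d_t=d_{t-1}+\epsilon_t w_t(\mathbf{1}(i_t)-\mathbf{1}(j_t))$, where $\mathbf{1}(i)$ is the $i$-th standard basis vector. In the adaptive weighted setting, the weight $w_t\in[0,1]$ is an arbitrary function of $e_1,\ldots,e_{t-1}$ (chosen by an adversary), while the edges $e_t$ remain i.i.d. uniform in $E(G)$. The algorithm does not depend on the adversary. *)

(* Defs.v *)
From HB Require Import structures.
From mathcomp Require Export all_boot all_order all_algebra.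
From mathcomp Require Export all_classical all_reals all_analysis.
Export Order.TTheory GRing.Theory Num.Theory.
Export numFieldNormedType.Exports.

Set Implicit Arguments.
Unset Strict Implicit.
Unset Printing Implicit Defensive.

Local Open Scope ring_scope.

Record sgraph (n : nat) := SGraph {
  adj :> rel 'I_n;
  adj_sym : symmetric adj;
  adj_irr : irreflexive adj
}.

Definition regular (n : nat) (G : sgraph n) (Delta : nat) : Prop :=
  forall v : 'I_n, #|[set u | G v u]| = Delta.

(* The unordered pair {i, j} is represented by the ordered pair (i, j) with
   i < j, so every edge of G occurs exactly once in [edges G].  Since the
   algorithm is free to choose the sign of 1(i) - 1(j), the choice of the
   representative is immaterial. *)
Definition edge (n : nat) : finType := ('I_n * 'I_n)%type.

Definition edges (n : nat) (G : sgraph n) : {set edge n} :=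
  [set e : edge n | (e.1 < e.2)%N && G e.1 e.2].

(* All histories below are listed with the most recent item first. *)

Definition request (R : realType) (n : nat) : Type := (edge n * R)%type.

(* A deterministic online algorithm: the argument is the list of all requests
   revealed so far, with the current one at its head; the boolean b returned
   encodes the sign (-1) ^+ b. *)
Definition algorithm (R : realType) (n : nat) : Type :=
  seq (request R n) -> bool.

(* An adaptive adversary: the weight w_t is the value on the list of the
   previous edges e_(t-1), ..., e_1 (whose length determines t).  The
   unweighted setting is the constant adversary 1, and weights fixed in advance
   are the adversaries depending only on the length of the history. *)
Definition adversary (R : realType) (n : nat) : Type := seq (edge n) -> R.

Definition valid_adversary (R : realType) (n : nat) (w : adversary R n) : Prop :=
  forall h, 0 <= w h <= 1.

Fixpoint requests (R : realType) (n : nat) (w : adversary R n)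
    (h : seq (edge n)) : seq (request R n) :=
  if h is e :: h' then (e, w h') :: requests w h' else [::].

Definition basis (R : realType) (n : nat) (i : 'I_n) : 'rV[R]_n := delta_mx 0 i.

Fixpoint discrepancy (R : realType) (n : nat) (A : algorithm R n)
    (w : adversary R n) (h : seq (edge n)) : 'rV[R]_n :=
  if h is e :: h' then
    discrepancy A w h'
      + ((-1) ^+ A (requests w h) * w h') *: (basis R e.1 - basis R e.2)
  else 0.

(* Here es = e_1, ..., e_T is in chronological order, and [`|d|] is the
   sup-norm of the row vector d. *)
Definition max_discrepancy (R : realType) (n T : nat) (A : algorithm R n)
    (w : adversary R n) (es : T.-tuple (edge n)) : R :=
  \big[Num.max/0]_(t < T.+1) `|discrepancy A w (rev (take t es))|.

Definition uniform_edge (R : realType) (n : nat) (G : sgraph n) (e : edge n) : R :=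
  if e \in edges G then #|edges G|%:R^-1 else 0.

(* Probability of the event P under the law of T independent uniform edges, that
   is, under the T-fold product of [uniform_edge]. *)
Definition iid_prob (R : realType) (n : nat) (G : sgraph n) (T : nat)
    (P : pred (T.-tuple (edge n))) : R :=
  \sum_(es : T.-tuple (edge n) | P es) \prod_(t < T) uniform_edge R G (tnth es t).
Arguments iid_prob R {n} G T P.

(* Main.v *)
(* Run greedy (move the weight from the end of larger discrepancy to the other
   one), restarted after every n/16 edges: there are O(K) phases, each of which
   is subcritical, so that w.h.p. connected sets of edges of one phase have
   O(log n) edges.

   Deterministic part, for one phase.  Call an edge hot at level th if both its
   ends exceed th when it arrives, and let C be the hot component of v.  The
   excess F_b = sum over u in C of (d_u - b)^+ can only rise when both ends lie
   within 1 of b, and then by at most 1, while the convexity of F in b bounds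
   it below at b - 3.  Hence if v reaches level L, the maxima of F_b grow
   quadratically in (L - b), and the component has at least c (L - th)^3 edges;
   this yields (i).  For (ii), a vertex that gets above th + 9 has at least 9
   edges hot at level th, so if the component at level th + 9 has at least half
   of the vertices of the one at level th, the latter has at least twice as many
   edges as vertices.  This must happen at one of the first O(log log n) levels,
   and then a constant fraction of the c L^3 edges of the component are in
   excess of a spanning tree; each of them costs a factor
   O((log n)^2 / Delta) in the union bound.

   The union bound runs over depth-first codes: there are at most
   2 (4 Delta)^m codes of length m at a vertex, and each occurs in a phase with
   probability at most (8 Delta)^-m. *)
Require Import Defs.
From mathcomp Require Import zify ring lra.

Set Implicit Arguments.
Unset Strict Implicit.
Unset Printing Implicit Defensive.

Local Open Scope ring_scope.

(** * Codes of connected edge multisets *)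

Definition mkedge n (u a : 'I_n) : edge n := if (u < a)%N then (u, a) else (a, u).

Definition incident n (x : 'I_n) (e : edge n) : bool := (x == e.1) || (x == e.2).

Definition vset n (u : 'I_n) (f : seq (edge n)) : {set 'I_n} :=
  [set x | (x == u) || has (incident x) f].

Inductive code n (G : sgraph n) : 'I_n -> seq (edge n) -> Prop :=
| code_nil u : code G u [::]
| code_cons u a s1 s2 : G u a -> code G a s1 -> code G u s2 ->
    code G u (mkedge u a :: s1 ++ s2).

Section Codes.
Context (n : nat) (G : sgraph n).
Implicit Types (u v x y : 'I_n) (f g r : seq (edge n)).

Lemma incident_mkedge x u a : incident x (mkedge u a) = (x == u) || (x == a).
Proof. by rewrite /incident /mkedge; case: ifP => _ //=; rewrite orbC. Qed.

Lemma mem_vset x u f : (x \in vset u f) = (x == u) || has (incident x) f.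
Proof. by rewrite inE. Qed.

Lemma vset_root u f : u \in vset u f.
Proof. by rewrite mem_vset eqxx. Qed.

Lemma vset_perm u f g : perm_eq f g -> vset u f = vset u g.
Proof. by move=> fg; apply/setP=> x; rewrite !mem_vset (perm_has _ fg). Qed.

Lemma vset_nil u : vset u [::] = [set u].
Proof. by apply/setP=> x; rewrite mem_vset !inE orbF. Qed.

Lemma vset_cons u e f : e.1 \in vset u f -> vset u (e :: f) = e.2 |: vset u f.
Proof.
move=> e1; apply/setP=> x; rewrite in_setU1 !mem_vset /= /incident.
case: (eqVneq x e.1) => [->|_] /=; last by rewrite orbCA.
by rewrite orbT; symmetry; move: e1; rewrite mem_vset => ->; rewrite orbT.
Qed.

Lemma vset_cons2 u e f : e.2 \in vset u f -> vset u (e :: f) = e.1 |: vset u f.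
Proof.
move=> e1; apply/setP=> x; rewrite in_setU1 !mem_vset /= /incident.
case: (eqVneq x e.2) => [->|_] /=; last by rewrite orbF orbCA.
by rewrite orbT orbT; symmetry; move: e1; rewrite mem_vset => ->; rewrite orbT.
Qed.

Lemma edges_mkedge (e : edge n) : e \in edges G ->
  [/\ G e.1 e.2, mkedge e.1 e.2 = e & mkedge e.2 e.1 = e].
Proof.
case: e => i j; rewrite inE /= => /andP[ij Gij]; split=> //.
  by rewrite /mkedge ij.
by rewrite /mkedge ltnNge ltnW.
Qed.

Lemma code_insert u f x y : code G u f -> x \in vset u f -> G x y ->
  exists2 f', code G u f' & perm_eq f' (mkedge x y :: f).
Proof.
move=> cf xf Gxy; elim: {u f} cf xf => [u|u a s1 s2 Gua c1 IH1 c2 IH2].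
  rewrite vset_nil inE => /eqP <-.
  by exists [:: mkedge x y] => //; apply: (@code_cons _ _ x y [::] [::]) => //; apply: code_nil.
rewrite mem_vset /= has_cat incident_mkedge => H.
have [x1|x2] : x \in vset a s1 \/ x \in vset u s2.
  rewrite !mem_vset; move: H.
  by case: (x == u) (x == a) (has _ s1) (has _ s2) => [] [] [] []; intuition.
- have [f' c' p'] := IH1 x1.
  exists (mkedge u a :: f' ++ s2); first exact: code_cons.
  apply/permP=> p; move/permP/(_ p): p'; rewrite /= !count_cat /= => E; clear -E; lia.
- have [f' c' p'] := IH2 x2.
  exists (mkedge u a :: s1 ++ f'); first exact: code_cons.
  apply/permP=> p; move/permP/(_ p): p'; rewrite /= !count_cat /= => E; clear -E; lia.
Qed.

Lemma code_insert_edge u f e : code G u f -> e \in edges G ->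
  (e.1 \in vset u f) || (e.2 \in vset u f) ->
  exists2 f', code G u f' & perm_eq f' (e :: f).
Proof.
move=> cf /edges_mkedge[Ge E1 E2] /orP[] ef.
- by have := code_insert cf ef Ge; rewrite E1.
- by rewrite adj_sym in Ge; have := code_insert cf ef Ge; rewrite E2.
Qed.

Lemma code_insert_all u f r : code G u f -> {subset r <= edges G} ->
  {in r, forall e, e.1 \in vset u f} ->
  exists2 f', code G u f' & perm_eq f' (f ++ r).
Proof.
move=> cf; elim: r => [|e r IH] rG rf; first by exists f; rewrite ?cats0.
have [||f' c' p'] := IH; first by move=> x xr; rewrite rG ?in_cons ?xr ?orbT.
  by move=> x xr; rewrite rf ?in_cons ?xr ?orbT.
have e1 : e.1 \in vset u f'.
  rewrite (vset_perm _ p') mem_vset has_cat.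
  by have := rf e (mem_head _ _); rewrite mem_vset => /orP[->|->//]; rewrite ?orbT.
have [|f2 c2 p2] := code_insert_edge c' (rG e (mem_head _ _)); first by rewrite e1.
exists f2 => //; apply/permP=> p.
by have /permP/(_ p) := p2; move/permP/(_ p): p'; rewrite /= !count_cat /= => E; clear -E; lia.
Qed.

(* Here [f] spans the component of [v], and [z] holds its remaining edges. *)
Lemma component v (g : seq (edge n)) : {subset g <= edges G} ->
  exists f z r, [/\ perm_eq g (f ++ z ++ r), code G v f,
    #|vset v f| = (size f).+1,
    {in z, forall e, (e.1 \in vset v f) && (e.2 \in vset v f)} &
    {in r, forall e, (e.1 \notin vset v f) && (e.2 \notin vset v f)}].
Proof.
move=> gG.
suff grow m : forall r f, (size r <= m)%N -> {subset r <= edges G} -> code G v f ->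
    #|vset v f| = (size f).+1 ->
    exists f' z r', [/\ perm_eq (f ++ r) (f' ++ z ++ r'), code G v f',
    #|vset v f'| = (size f').+1,
    {in z, forall e, (e.1 \in vset v f') && (e.2 \in vset v f')} &
    {in r', forall e, (e.1 \notin vset v f') && (e.2 \notin vset v f')}].
  by apply: (grow _ g [::]) => //; [apply: code_nil | rewrite vset_nil cards1].
elim: m => [|m IH] r f rm rG cf Cf.
  exists f, [::], [::]; rewrite leqn0 size_eq0 in rm.
  by rewrite (eqP rm).
set C := vset v f.
have [/hasP[e er eC]|/hasPn noe] := boolP (has (fun e => (e.1 \in C) != (e.2 \in C)) r).
- have eC' : (e.1 \in C) || (e.2 \in C) by move: eC; case: (_ \in C) (_ \in C) => [] [].
  have [f1 c1 p1] := code_insert_edge cf (rG _ er) eC'.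
  have [||||f' [z [r' [p' c' C' z' r'']]]] := IH (rem e r) f1.
  + by rewrite size_rem // -ltnS prednK //; case: (r) er.
  + by move=> y /mem_rem; apply: rG.
  + by [].
  + rewrite (vset_perm _ p1) (perm_size p1) /= -Cf -/C.
    have [e1|e1] := boolP (e.1 \in C).
      by rewrite (vset_cons e1) cardsU1 -/C; move: eC; rewrite e1; case: (_ \in C).
    by move: eC'; rewrite (negPf e1) => /= e2; rewrite (vset_cons2 e2) cardsU1 -/C e1.
  exists f', z, r'; split=> //; apply: perm_trans p'.
  apply/permP=> p; move/permP/(_ p): (perm_to_rem er); move/permP/(_ p): p1.
  by rewrite /= !count_cat /= => E1 E2; clear -E1 E2; lia.
- exists f, [seq e <- r | e.1 \in C], [seq e <- r | e.1 \notin C]; split=> //.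
  + by rewrite perm_cat2l perm_sym; apply/permPl/perm_filterC.
  + by move=> e; rewrite mem_filter => /andP[e1 /noe]; rewrite e1 negbK => /eqP <-.
  + by move=> e; rewrite mem_filter => /andP[e1 /noe]; rewrite negbK => /eqP <-; rewrite e1.
Qed.

Lemma code_closed u f (C : {set 'I_n}) : code G u f -> u \in C ->
  {in f, forall e, (e.1 \in C) = (e.2 \in C)} -> vset u f \subset C.
Proof.
move=> cf; elim: {u f} cf => [u|u a s1 s2 Gua c1 IH1 c2 IH2] uC sC.
  by rewrite vset_nil finset.sub1set.
have aC : a \in C.
  by have := sC _ (mem_head _ _); rewrite /mkedge; case: ifP => _ /= E; move: uC; rewrite E.
have s1C : vset a s1 \subset C.
  by apply: IH1 => // e es; apply: sC; rewrite in_cons mem_cat es orbT.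
have s2C : vset u s2 \subset C.
  by apply: IH2 => // e es; apply: sC; rewrite in_cons mem_cat es !orbT.
apply/fintype.subsetP => x; rewrite mem_vset /= has_cat incident_mkedge.
case: (eqVneq x u) => [->//|_] /=; case: (eqVneq x a) => [->//|_] /= /orP[xs|xs].
  by apply: (fintype.subsetP s1C); rewrite mem_vset xs orbT.
by apply: (fintype.subsetP s2C); rewrite mem_vset xs orbT.
Qed.

End Codes.

(** * The cubic lower bound for greedy *)

Lemma max0P (R : realDomainType) (x : R) :
  (x <= 0) /\ Num.max 0 x = 0 \/ (0 <= x) /\ Num.max 0 x = x.
Proof. by rewrite maxElt; have [x0|x0] := ltP 0 x; [right; rewrite ltW | left]. Qed.

Lemma cube_le_sum K : (K ^ 3 <= 3 * \sum_(k < K) (k.+1 * k).+1)%N.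
Proof.
elim: K => [|k IH]; first by rewrite big_ord0.
rewrite big_ord_recr /= mulnDr; move: (bigop _ _ _) IH => S.
rewrite !expnS !expn0; nia.
Qed.

Section Greedy.
Context (R : realType) (n : nat).
Implicit Types (d : 'I_n -> R) (rs h : seq (request R n)) (C : {set 'I_n}).

Definition greedy_process (D : seq (request R n) -> 'I_n -> R) : Prop :=
  (forall u, D [::] u = 0) /\
  forall e w h, exists hi lo : 'I_n, [/\ e = (hi, lo) \/ e = (lo, hi), D h lo <= D h hi
    & forall u, D ((e, w) :: h) u = D h u - w *+ (u == hi) + w *+ (u == lo)].

Definition valid_requests rs : bool :=
  all (fun r => (0 <= r.2 <= 1) && (r.1.1 != r.1.2)) rs.

Definition excess C (b : R) d : R := \sum_(u in C) Num.max 0 (d u - b).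

Lemma sum_indicator C (a : 'I_n) (x : R) :
  \sum_(u in C) x *+ (u == a) = x *+ (a \in C).
Proof.
rewrite big_mkcond (bigD1 a) //= eqxx big1 ?addr0; first by case: ifP.
by move=> u /negPf ->; case: ifP.
Qed.

Lemma excess_step C (b w : R) d d' (hi lo : 'I_n) :
  hi != lo -> 0 <= w <= 1 -> d lo <= d hi ->
  (forall u, d' u = d u - w *+ (u == hi) + w *+ (u == lo)) ->
  (b - 1 < d lo -> (hi \in C) = (lo \in C)) ->
  excess C b d' <= excess C b d + 1 /\
  (excess C b d < excess C b d' ->
   [/\ hi \in C, lo \in C, b - 1 < d lo & d hi < b + 1]).
Proof.
move=> hl /andP[w0 w1] dd d'E HC.
have -> : excess C b d' = excess C b d
  + (Num.max 0 (d hi - w - b) - Num.max 0 (d hi - b)) *+ (hi \in C)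
  + (Num.max 0 (d lo + w - b) - Num.max 0 (d lo - b)) *+ (lo \in C).
  rewrite -!sum_indicator -!big_split /=; apply: eq_bigr => u _; rewrite d'E.
  have [->|uh] := eqVneq u hi.
    by rewrite (negPf hl) !mulr1n !mulr0n !addr0; ring.
  by have [->|ul] := eqVneq u lo; rewrite !mulr0n ?mulr1n ?subr0 ?addr0 //; ring.
have [B|B] := ltP (b - 1) (d lo).
  rewrite (HC B); case: (lo \in C); rewrite ?mulr1n ?mulr0n ?addr0; last by split; lra.
  have [] := max0P (d hi - w - b); have [] := max0P (d hi - b);
  have [] := max0P (d lo + w - b); have [] := max0P (d lo - b);
  move=> [A1 ->] [A2 ->] [A3 ->] [A4 ->]; clear HC d'E hl;
  split; try lra; move=> H; split=> //; lra.
have -> : Num.max 0 (d lo + w - b) = 0.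
  by have [] := max0P (d lo + w - b) => [] [A1 ->] //; lra.
have -> : Num.max 0 (d lo - b) = 0.
  by have [] := max0P (d lo - b) => [] [A1 ->] //; lra.
have : Num.max 0 (d hi - w - b) <= Num.max 0 (d hi - b).
  by have [] := max0P (d hi - w - b); have [] := max0P (d hi - b) => [] [A1 ->] [A2 ->]; lra.
clear HC d'E; rewrite subrr mul0rn addr0.
by case: (hi \in C); rewrite ?mulr1n ?mulr0n ?addr0 => H; split; lra.
Qed.

Lemma excess_convex C (b : R) d (hi lo : 'I_n) : hi != lo -> hi \in C -> lo \in C ->
  b - 1 < d lo -> d lo <= d hi -> d hi < b + 1 ->
  2 * excess C b d + 4 <= excess C (b + 3) d + excess C (b - 3) d.
Proof.
move=> hl hC lC dl dd dh.
have -> : 2 * excess C b d + 4 = \sum_(u in C)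
    (2 * Num.max 0 (d u - b) + 2 *+ (u == hi) + 2 *+ (u == lo)).
  by rewrite !big_split !sum_indicator hC lC -mulr_sumr /= /excess; ring.
rewrite -big_split; apply: ler_sum => u _ /=.
have hat (x : R) : 2 * Num.max 0 (x - b) <= Num.max 0 (x - (b + 3)) + Num.max 0 (x - (b - 3)).
  have [] := max0P (x - b); have [] := max0P (x - (b + 3));
  have [] := max0P (x - (b - 3)) => [] [A1 ->] [A2 ->] [A3 ->]; lra.
have peak (x : R) : b - 1 < x < b + 1 ->
    2 * Num.max 0 (x - b) + 2 <= Num.max 0 (x - (b + 3)) + Num.max 0 (x - (b - 3)).
  move=> /andP[x1 x2]; have [] := max0P (x - b); have [] := max0P (x - (b + 3));
  have [] := max0P (x - (b - 3)) => [] [A1 ->] [A2 ->] [A3 ->]; lra.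
have [->|uh] := eqVneq u hi.
  rewrite (negPf hl) mulr1n mulr0n addr0; apply: peak.
  by rewrite dh (lt_le_trans dl dd).
have [->|ul] := eqVneq u lo; rewrite ?mulr1n !mulr0n !addr0 //; apply: peak.
by rewrite dl (le_lt_trans dd dh).
Qed.

Lemma excess_anti C (b b' : R) d : b <= b' -> excess C b' d <= excess C b d.
Proof.
move=> bb; apply: ler_sum => u _.
by have [] := max0P (d u - b); have [] := max0P (d u - b') => [] [A ->] [B ->]; lra.
Qed.

Lemma excess_ge C b d v : v \in C -> d v - b <= excess C b d.
Proof.
move=> vC; rewrite /excess (bigD1 v) //= -[leLHS]addr0 lerD //.
  by rewrite le_max lexx orbT.
by apply: sumr_ge0 => u _; rewrite le_max lexx.
Qed.

Context (D : seq (request R n) -> 'I_n -> R) (gD : greedy_process D).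

Fixpoint hot (th : R) rs : seq (edge n) :=
  if rs is r :: h then
    if (th < D h r.1.1) && (th < D h r.1.2) then r.1 :: hot th h else hot th h
  else [::].

Definition edge_closed C (g : seq (edge n)) : Prop :=
  {in g, forall e, (e.1 \in C) = (e.2 \in C)}.

Fixpoint reached C (b a : R) rs : bool :=
  (a <= excess C b (D rs)) || (if rs is _ :: h then reached C b a h else false).

Fixpoint rises C (b : R) rs : nat :=
  if rs is _ :: h then (rises C b h + (excess C b (D h) < excess C b (D rs))%R)%N
  else 0.

Lemma closed_tail C th r h : edge_closed C (hot th (r :: h)) -> edge_closed C (hot th h).
Proof. by move=> /= H e eh; apply: H; case: ifP; rewrite ?in_cons ?eh ?orbT. Qed.

Lemma excess_nil C b : 0 <= b -> excess C b (D [::]) = 0.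
Proof.
move=> b0; apply: big1 => u _; have [D0 _] := gD.
by rewrite D0 sub0r maxElt oppr_gt0 ltNge b0.
Qed.

Lemma process_step C th b r h : valid_requests (r :: h) -> edge_closed C (hot th (r :: h)) ->
  th + 1 <= b ->
  excess C b (D (r :: h)) <= excess C b (D h) + 1 /\
  (excess C b (D h) < excess C b (D (r :: h)) ->
   exists hi lo, [/\ r.1 = (hi, lo) \/ r.1 = (lo, hi), hi != lo,
     (hi \in C) && (lo \in C), D h lo <= D h hi &
      b - 1 < D h lo /\ D h hi < b + 1]).
Proof.
case: r => e w /= /andP[/andP[w01 e12] vh] cl thb.
have [_ /(_ e w h)[hi [lo [E dd D'E]]]] := gD.
have hl : hi != lo by case: E e12 => -> //=; rewrite eq_sym.
have [|le1 H] := excess_step (C := C) (b := b) hl w01 dd D'E.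
  move=> bl; have := cl e.
  have -> : (th < D h e.1) && (th < D h e.2).
    by case: E => -> /=; apply/andP; split; lra.
  by move=> /(_ (mem_head _ _)); case: E => -> /=.
split=> // /H[hC lC bl bh]; exists hi, lo.
by rewrite hC lC.
Qed.

Lemma excess_le_rises C th b rs : valid_requests rs -> edge_closed C (hot th rs) ->
  0 <= b -> th + 1 <= b -> excess C b (D rs) <= (rises C b rs)%:R.
Proof.
elim: rs => [|r h IH] v cl b0 thb; first by rewrite excess_nil.
have vh : valid_requests h by move: v => /andP[].
have {}IH := IH vh (closed_tail cl) b0 thb.
have [le1 _] := process_step v cl thb.
rewrite [rises _ _ _]/=; case: ltP => H.
  by rewrite natrD mulr1n (le_trans le1) // lerD2r.
by rewrite addn0 (le_trans H).
Qed.

Lemma reached_rises C th b a rs : valid_requests rs -> edge_closed C (hot th rs) ->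
  0 <= b -> th + 1 <= b -> reached C b a rs -> a <= (rises C b rs)%:R.
Proof.
elim: rs => [|r h IH] v cl b0 thb.
  by rewrite /= orbF => H; rewrite (le_trans H) // excess_nil.
rewrite [reached _ _ _ _]/= => /orP[H|H].
  by rewrite (le_trans H) // (excess_le_rises v cl).
have vh : valid_requests h by move: v => /andP[].
by apply: le_trans (IH vh (closed_tail cl) b0 thb H) _; rewrite ler_nat /= leq_addr.
Qed.

Lemma reached_now C b a rs : a <= excess C b (D rs) -> reached C b a rs.
Proof. by case: rs => [|r h] /= ->. Qed.

Section Pyramid.
Context (C : {set 'I_n}) (th B : R) (K : nat).
Hypotheses (th0 : 0 <= th) (thB : th + 1 <= B - 3 * K%:R).

Let lev (k : nat) : R := B - 3 * k%:R.
Let thr (k : nat) : nat := (k * k.-1).+1.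

Let lev_th k : (k <= K)%N -> th + 1 <= lev k.
Proof.
move=> kK; apply: le_trans thB _; rewrite /lev lerD2l lerN2 ler_wpM2l //.
by rewrite ler_nat.
Qed.

(* [thr] solves the recurrence [thr (k+1) = 2 thr k - thr (k-1) + 2], which is
   what convexity of the excess yields at the first time that [thr k] is
   reached, the threshold of the higher level [k-1] not being reached yet. *)
Lemma reached_lower rs k : valid_requests rs -> edge_closed C (hot th rs) -> (k <= K)%N ->
  reached C (lev k) (thr k)%:R rs -> reached C (lev k.+1) (thr k.+1)%:R rs.
Proof.
elim: rs k => [|r h IH] k v cl kK.
  rewrite /= orbF excess_nil; last by apply: le_trans (lev_th kK); rewrite addr_ge0.
  by rewrite lern0.
have vh : valid_requests h by move: v => /andP[].
have {}IH j := IH j vh (closed_tail cl).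
have reS j a : reached C (lev j) a h -> reached C (lev j) a (r :: h).
  by move=> /= ->; rewrite orbT.
rewrite [X in X -> _]/= => /orP[H|/IH H]; last by apply/reS/H.
have [H1|H1] := boolP (reached C (lev k) (thr k)%:R h); first exact/reS/IH.
have lt1 : excess C (lev k) (D h) < (thr k)%:R.
  by rewrite ltNge; apply: contra H1 => /reached_now.
case: k => [|k] in kK H H1 lt1 *.
  apply/reached_now/(le_trans H)/excess_anti; rewrite /lev; lra.
have lt2 : excess C (lev k) (D h) < (thr k)%:R.
  rewrite ltNge; apply: contra H1 => /reached_now; apply: IH; lia.
have [le1 /(_ _)[|hi [lo [E hl /andP[hC lC] dd [bl bh]]]]] := process_step v cl (lev_th kK).
  exact: lt_le_trans H.
apply/reS/reached_now.
have := excess_convex hl hC lC bl dd bh.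
have -> : lev k.+1 + 3 = lev k by rewrite /lev -natr1; ring.
have -> : lev k.+1 - 3 = lev k.+2 by rewrite /lev -!natr1; ring.
have thrE : (2 * thr k.+1 + 2 = thr k + thr k.+2)%N.
  by rewrite /thr; case: (k) => [|m] //=; clear; nia.
have := congr1 (fun m => m%:R : R) thrE; rewrite /= !natrD natrM.
move: (thr k) (thr k.+1) (thr k.+2) H lt1 lt2 => a1 a2 a3 H lt1 lt2.
clear -lt1 lt2 H le1; lra.
Qed.

Lemma sum_rises_le rs : valid_requests rs -> edge_closed C (hot th rs) ->
  (\sum_(k < K.+1) rises C (lev k) rs <= count (fun e => e.1 \in C) (hot th rs))%N.
Proof.
elim: rs => [|r h IH] v cl; first by rewrite big1.
have vh : valid_requests h by move: v => /andP[].
have {}IH := IH vh (closed_tail cl).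
have -> : (\sum_(k < K.+1) rises C (lev k) (r :: h) = \sum_(k < K.+1) rises C (lev k) h
   + \sum_(k < K.+1) (excess C (lev k) (D h) < excess C (lev k) (D (r :: h)))%R)%N.
  by rewrite -big_split.
have [/existsP[k kr]|/existsPn no] := boolP
   [exists k : 'I_K.+1, excess C (lev k) (D h) < excess C (lev k) (D (r :: h))]; last first.
  rewrite [X in (_ + X)%N]big1 ?addn0; last by move=> i _; rewrite (negPf (no i)).
  by apply: leq_trans IH _; rewrite [hot _ (_ :: _)]/=; case: ifP => //= _; rewrite leq_addl.
have thk (i : 'I_K.+1) : th + 1 <= lev i by apply: lev_th; rewrite -ltnS.
have [_ /(_ kr)[hi [lo [E hl /andP[hC lC] dd [bl bh]]]]] := process_step v cl (thk k).
have -> : (\sum_(i < K.+1) (excess C (lev i) (D h) < excess C (lev i) (D (r :: h)))%R = 1)%N.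
  rewrite (bigD1 k) // big1; first by rewrite kr.
  move=> i /andP[_ ik]; apply/eqP; rewrite eqb0; apply/negP => ir.
  have [_ /(_ ir)[hi' [lo' [E' hl' _ dd' [bl' bh']]]]] := process_step v cl (thk i).
  have [lik lki] : lev i < lev k + 2 /\ lev k < lev i + 2.
    case: E E' => -> [] [? ?]; subst hi' lo'; split; lra.
  case: (ltngtP i k) => [ki|ki|/val_inj iK]; last by rewrite iK eqxx in ik.
  - have : i.+1%:R <= k%:R :> R by rewrite ler_nat.
    move: lik; rewrite /lev -natr1; lra.
  - have : k.+1%:R <= i%:R :> R by rewrite ler_nat.
    move: lki; rewrite /lev -natr1; lra.
have -> : hot th (r :: h) = r.1 :: hot th h.
  have tk := thk k; have t1 : th < D h lo by lra.
  have t2 := lt_le_trans t1 dd.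
  by case: E => /= ->; rewrite /= t1 t2.
by rewrite /= addnC leq_add //; case: E => -> /=; rewrite ?hC ?lC.
Qed.

End Pyramid.

Lemma cubic_edge_count C th K rs v : 0 <= th -> valid_requests rs -> edge_closed C (hot th rs) -> v \in C ->
  th + 3 * K%:R - 1 <= D rs v ->
  (K ^ 3 <= 3 * count (fun e => e.1 \in C) (hot th rs))%N.
Proof.
move=> th0 vr cl vC DL.
have [->|K0] := posnP K; first by rewrite exp0n.
pose B := th + 1 + 3 * K%:R.
have thB : th + 1 <= B - 3 * K%:R by rewrite /B; lra.
have re k : (k <= K)%N -> reached C (B - 3 * k.+1%:R) (k.+1 * k).+1%:R rs.
  elim: k => [|k IH] kK.
    apply: reached_now; apply: le_trans (excess_ge (B - 3 * 1) (D rs) vC).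
    by rewrite muln0 /B; lra.
  exact: (reached_lower (k := k.+1) th0 thB vr cl kK (IH (ltnW kK))).
have ri k : (k < K)%N -> ((k.+1 * k).+1 <= rises C (B - 3 * k.+1%:R) rs)%N.
  move=> kK; have k1K : (k.+1%:R <= K%:R :> R) by rewrite ler_nat.
  have := reached_rises vr cl _ _ (re k (ltnW kK)).
  by rewrite ler_nat => ->//; move: th0 thB k1K; lra.
apply: leq_trans (cube_le_sum K) _.
rewrite leq_mul2l /=; apply: leq_trans (sum_rises_le thB vr cl).
rewrite big_ord_recl /=; apply: leq_trans (leq_addl _ _).
by apply: leq_sum => i _; apply: ri.
Qed.

End Greedy.

(** * Dense hot components *)

Section Descent.
Context (R : realType) (n : nat) (D : seq (request R n) -> 'I_n -> R).
Hypothesis gD : greedy_process D.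
Implicit Types (rs h : seq (request R n)) (C : {set 'I_n}) (th : R).

Lemma hot_sub rs th : exists r, perm_eq (unzip1 rs) (hot D th rs ++ r).
Proof.
elim: rs => [|a h [r IH]]; first by exists [::].
rewrite /=; case: ifP => _; first by exists r; rewrite cat_cons perm_cons.
by exists (a.1 :: r); rewrite -cat1s -[a.1 :: r]cat1s perm_sym perm_catCA perm_cat2l perm_sym.
Qed.

Lemma hot_anti rs th th' : th <= th' -> {subset hot D th' rs <= hot D th rs}.
Proof.
move=> tt e; elim: rs => //= r h IH.
have [/andP[t1 t2]|_] := ifP; last by move=> /IH; case: ifP => _; rewrite ?in_cons => -> //; rewrite orbT.
rewrite (le_lt_trans tt t1) (le_lt_trans tt t2) !in_cons => /orP[->//|/IH ->].
by rewrite orbT.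
Qed.

Lemma hot_degree rs th u : valid_requests rs -> 0 <= th ->
  D rs u - th - 1 <= (count (incident u) (hot D th rs))%:R.
Proof.
move=> v th0; elim: rs v => [|[e w] h IH] v.
  by have [D0 _] := gD; rewrite D0 /=; lra.
move: v => /= /andP[/andP[/andP[w0 w1] e12] /IH {}IH].
have [_ /(_ e w h)[hi [lo [E dd ->]]]] := gD.
have le_cnt : (count (incident u) (hot D th h) <= count (incident u)
   (if ((th < D h e.1) && (th < D h e.2))%R then e :: hot D th h else hot D th h))%N.
  by case: ifP => //= _; rewrite leq_addl.
have [ulo|_] := eqVneq u lo; last first.
  apply: le_trans (_ : (count (incident u) (hot D th h))%:R <= _); last by rewrite ler_nat.
  by apply: le_trans IH; case: (u == hi); rewrite ?mulr1n ?mulr0n; lra.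
have uhi : u != hi by rewrite ulo; case: E e12 => -> /=; rewrite // eq_sym.
rewrite (negPf uhi) mulr0n mulr1n.
have [tlo|tlo] := ltP th (D h lo); last first.
  by apply: le_trans (ler0n _ _); rewrite ulo; lra.
have thi := lt_le_trans tlo dd.
have -> : (th < D h e.1) && (th < D h e.2) by case: E => -> /=; rewrite tlo thi.
have -> : count (incident u) (e :: hot D th h) = (count (incident u) (hot D th h)).+1.
  by rewrite /= /incident ulo; case: E => -> /=; rewrite eqxx ?orbT.
rewrite -natr1; lra.
Qed.

Lemma hot_degree_lt rs th th' u e : valid_requests rs -> 0 <= th -> e \in hot D th' rs ->
  incident u e -> th' - th - 1 < (count (incident u) (hot D th rs))%:R.
Proof.
move=> v th0; elim: rs v => //= r h IH /andP[_ vh].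
have le_cnt : (count (incident u) (hot D th h) <= count (incident u)
   (if ((th < D h r.1.1) && (th < D h r.1.2))%R then r.1 :: hot D th h else hot D th h))%N.
  by case: ifP => //= _; rewrite leq_addl.
move=> eh ue; apply: lt_le_trans (_ : (count (incident u) (hot D th h))%:R <= _); last first.
  by rewrite ler_nat.
move: eh; case: ifP => [/andP[t1 t2]|_ /IH]; last exact.
rewrite in_cons => /orP[/eqP er|/IH]; last exact.
apply: lt_le_trans (hot_degree u vh th0).
by rewrite er in ue; case/orP: ue => /eqP ->; lra.
Qed.

Lemma sum_degrees C (g : seq (edge n)) : edge_closed C g ->
  (\sum_(u in C) count (incident u) g <= 2 * count (fun e => e.1 \in C) g)%N.
Proof.
elim: g => [|e g IH] cl; first by rewrite big1.
rewrite /= big_split mulnDr /= leq_add //; last by apply: IH => x xg; apply: cl; rewrite in_cons xg orbT.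
apply: leq_trans (_ : \sum_(u in C) ((u == e.1) + (u == e.2)) <= _)%N.
  by apply: leq_sum => u _; rewrite /incident; case: (u == e.1); case: (u == e.2).
have ind (a : 'I_n) : (\sum_(u in C) (u == a) = (a \in C))%N.
  rewrite big_mkcond (bigD1 a) //= eqxx big1 ?addn0; first by case: ifP.
  by move=> u /negPf ->; case: ifP.
by rewrite big_split /= !ind -(cl e (mem_head _ _)) addnn mul2n.
Qed.

Context (G : sgraph n) (v : 'I_n) (rs : seq (request R n)).
Hypotheses (valid_rs : valid_requests rs) (rsG : {subset unzip1 rs <= edges G}).

Definition hot_component th (f x : seq (edge n)) : Prop :=
  [/\ code G v f, #|vset v f| = (size f).+1,
    {in x, forall e, (e.1 \in vset v f) && (e.2 \in vset v f)},
    edge_closed (vset v f) (hot D th rs) /\ {subset f <= hot D th rs} &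
    (size f + size x = count (fun e => e.1 \in vset v f) (hot D th rs))%N /\
    exists r, perm_eq (unzip1 rs) (f ++ x ++ r)].

Lemma code_mem_vset f e : e \in f -> (e.1 \in vset v f) && (e.2 \in vset v f).
Proof.
move=> ef; rewrite !mem_vset; apply/andP; split; apply/orP; right; apply/hasP;
  by exists e; rewrite // /incident eqxx ?orbT.
Qed.

Lemma hot_componentP th : exists f x, hot_component th f x.
Proof.
have [r0 p0] := hot_sub rs th.
have [|f [x [r [p cf Cf xC rC]]]] := @component n G v (hot D th rs).
  by move=> e eh; apply: rsG; rewrite (perm_mem p0) mem_cat eh.
exists f, x; split=> //; first split.
- move=> e; rewrite (perm_mem p) !mem_cat => /or3P[/code_mem_vset|/xC|/rC] /andP[].
  + by move=> -> ->.
  + by move=> -> ->.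
  + by move=> /negPf -> /negPf ->.
- by move=> e ef; rewrite (perm_mem p) mem_cat ef.
split.
  rewrite (permP p) !count_cat.
  have /eqP -> : count (fun e => e.1 \in vset v f) f == size f.
    by rewrite -all_count; apply/allP => e /code_mem_vset /andP[].
  have /eqP -> : count (fun e => e.1 \in vset v f) x == size x.
    by rewrite -all_count; apply/allP => e /xC /andP[].
  have /eqP -> : count (fun e => e.1 \in vset v f) r == 0%N.
    by rewrite -leqn0 leqNgt -has_count; apply/hasPn => e /rC /andP[].
  by rewrite addn0.
by exists (r ++ r0); rewrite (permPl p0) (permPl (perm_cat p (perm_refl _))) !catA.
Qed.

Lemma hot_component_shrink th f x f' x' : 0 <= th -> th + 9 <= D rs v ->
  hot_component th f x -> hot_component (th + 9) f' x' ->
  (4 * (size f').+1 <= size f + size x)%N.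
Proof.
move=> th0 thv [cf Cf xC [cl fh] [sE _]] [cf' Cf' _ [cl' fh'] _].
have sub : vset v f' \subset vset v f.
  apply: (code_closed cf') => [|e /fh' eh]; first exact: vset_root.
  by apply: cl; apply: hot_anti eh; lra.
rewrite -(leq_pmul2l (ltn0Sn 1)) sE; apply: leq_trans (sum_degrees cl).
rewrite mulnA -Cf' -sum1_card big_distrr /=.
apply: leq_trans (_ : \sum_(u in vset v f') count (incident u) (hot D th rs) <= _)%N; last first.
  rewrite [X in (_ <= X)%N](bigID (mem (vset v f'))) /=.
  apply: leq_trans (leq_addr _ _); apply: eq_leq; apply: eq_bigl => u.
  by case: (boolP (u \in vset v f')) => [/(fintype.subsetP sub) ->|]; rewrite ?andbF.
apply: leq_sum => u; rewrite mem_vset muln1 => /orP[/eqP ->|/hasP[e /fh' eh ue]].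
  rewrite -(ler_nat R); apply: le_trans (hot_degree v valid_rs th0); lra.
by have := hot_degree_lt valid_rs th0 eh ue; rewrite -(ler_nat R); lra.
Qed.

Lemma dense_component J th f x : 0 <= th -> th + 9 * J.+1%:R <= D rs v ->
  hot_component th f x -> (size f < 2 ^ J)%N ->
  exists th' f' x', [/\ th <= th' <= th + 9 * J%:R, hot_component th' f' x' &
    (2 * (size f').+1 <= size f' + size x')%N].
Proof.
elim: J th f x => [|J IH] th f x th0 thv cf sf.
  have [f' [x' cf']] := hot_componentP (th + 9).
  have thv1 : th + 9 <= D rs v by lra.
  have le4 := hot_component_shrink th0 thv1 cf cf'; exists th, f, x; split=> //; first by rewrite mulr0 addr0 lexx.
  by apply: leq_trans le4; move: sf; rewrite expn0; lia.
have J0 : 0 <= J%:R :> R by [].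
have [f' [x' cf']] := hot_componentP (th + 9).
have thv1 : th + 9 <= D rs v by rewrite -natr1 in thv; lra.
have le4 := hot_component_shrink th0 thv1 cf cf'.
have [le2|lt2] := leqP (2 * (size f).+1) (size f + size x).
  by exists th, f, x; split=> //; rewrite lexx -natr1 /=; lra.
have [|||th' [f1 [x1 [/andP[t1 t2] c1 s1]]]] := IH (th + 9) f' x' _ _ cf'.
- by lra.
- by move: thv; rewrite -!natr1; lra.
- by move: sf; rewrite expnS; lia.
by exists th', f1, x1; split=> //; apply/andP; split; rewrite -?natr1; lra.
Qed.

Lemma large_code K : 3 * K%:R - 1 <= D rs v ->
  exists f, [/\ code G v f, exists r, perm_eq (unzip1 rs) (f ++ r) & (K ^ 3 <= 3 * size f)%N].
Proof.
move=> DK; have [f [x [cf Cf xC [cl fh] [sE [r p]]]]] := hot_componentP 0.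
have [||f' cf' p'] := code_insert_all (r := x) cf.
- by move=> e ex; apply: rsG; rewrite (perm_mem p) !mem_cat ex orbT.
- by move=> e /xC /andP[].
exists f'; split=> //; first by exists r; rewrite (permPl p) catA perm_cat2r perm_sym.
rewrite (perm_size p') size_cat sE; apply: (cubic_edge_count gD (lexx 0) valid_rs cl (vset_root _ _)).
by rewrite add0r.
Qed.

Lemma dense_code J K : (0 < K)%N -> 9 * J.+1%:R + 3 * K%:R - 1 <= D rs v ->
  (forall f r, code G v f -> perm_eq (unzip1 rs) (f ++ r) -> (size f < 2 ^ J)%N) ->
  exists f x, [/\ code G v f, {in x, forall e, (e.1 \in vset v f) && (e.2 \in vset v f)},
    exists r, perm_eq (unzip1 rs) (f ++ x ++ r) & (K ^ 3 <= 6 * size x)%N].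
Proof.
move=> K0 DK small; have K1 : 1 <= K%:R :> R by rewrite ler1n.
have [f0 [x0 c0]] := hot_componentP 0.
have [||th [f [x [/andP[th0 thJ] [cf Cf xC [cl fh] [sE [r p]]] s2]]]] :=
  @dense_component J 0 f0 x0 (lexx 0) _ c0.
- by rewrite add0r; lra.
- by case: c0 => c0 _ _ _ [_ [r p]]; apply: (small _ (x0 ++ r)).
exists f, x; split=> //; first by exists r.
have := cubic_edge_count gD (K := K) th0 valid_rs cl (vset_root _ _).
rewrite -sE => C3; apply: leq_trans (C3 _) _.
  by apply: le_trans DK; rewrite -natr1; lra.
by move: (size f) (size x) s2 => a b; clear; lia.
Qed.

End Descent.

(** * Greedy restarted in every phase *)

Section Algorithm.
Context (R : realType) (n : nat).
Implicit Types (rs h : seq (request R n)) (s g : seq (edge n)).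

Fixpoint greedy_disc rs : 'rV[R]_n :=
  if rs is r :: h then
    greedy_disc h + ((-1) ^+ (greedy_disc h 0 r.1.2 < greedy_disc h 0 r.1.1)%R * r.2)
      *: (basis R r.1.1 - basis R r.1.2)
  else 0.

Definition phase_greedy (ell : nat) : algorithm R n := fun rs =>
  if rs is r :: h then
    let d := greedy_disc (take (size h %% ell) h) in d 0 r.1.2 < d 0 r.1.1
  else false.

Lemma greedy_disc_cons e w h u : greedy_disc ((e, w) :: h) 0 u = greedy_disc h 0 u
  + (-1) ^+ (greedy_disc h 0 e.2 < greedy_disc h 0 e.1)%R * w * ((u == e.1)%:R - (u == e.2)%:R).
Proof. by rewrite /= !mxE /= (eq_sym u e.1) (eq_sym u e.2). Qed.

Lemma greedy_disc_process : greedy_process (fun rs u => greedy_disc rs 0 u).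
Proof.
split=> [u|e w h]; first by rewrite mxE.
have [lt|le] := ltP (greedy_disc h 0 e.2) (greedy_disc h 0 e.1).
- exists e.1, e.2; split=> [||u]; [by left; case: (e) | exact: ltW|].
  by rewrite greedy_disc_cons lt expr1 mulN1r mulNr mulrBr opprB !mulr_natr addrAC addrA.
- exists e.2, e.1; split=> [||u]; [by right; case: (e) | by []|].
  by rewrite greedy_disc_cons ltNge le expr0 mul1r mulrBr !mulr_natr addrAC addrA.
Qed.

Lemma greedy_process_opp (D : seq (request R n) -> 'I_n -> R) :
  greedy_process D -> greedy_process (fun rs u => - D rs u).
Proof.
move=> [D0 DS]; split=> [u|e w h]; first by rewrite D0 oppr0.
have [hi [lo [E dd De]]] := DS e w h; exists lo, hi.
split=> [||u]; [by case: E; [right|left] | by rewrite lerN2 | by rewrite De !opprD opprK addrAC].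
Qed.

Lemma size_requests (w : adversary R n) s : size (requests w s) = size s.
Proof. by elim: s => //= e s ->. Qed.

Lemma unzip1_requests (w : adversary R n) s : unzip1 (requests w s) = s.
Proof. by elim: s => //= e s ->. Qed.

Lemma requests_weight (w : adversary R n) s : valid_adversary w ->
  all (fun r => 0 <= r.2 <= 1) (requests w s).
Proof. by move=> vw; elim: s => //= e s ->; rewrite vw. Qed.

Lemma discrepancy_phase ell (w : adversary R n) g s : (ell %| size s)%N -> (size g <= ell)%N ->
  discrepancy (phase_greedy ell) w (g ++ s) =
  discrepancy (phase_greedy ell) w s + greedy_disc (take (size g) (requests w (g ++ s))).
Proof.
move=> es; elim: g => [|e g IH] ge; first by rewrite take0 addr0.
have gl : (size (g ++ s) %% ell = size g)%N.
  by rewrite size_cat -modnDmr (eqP es) addn0 modn_small.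
rewrite cat_cons [LHS]/= IH ?(ltnW ge) // size_requests gl.
by rewrite [size (e :: g)]/= [requests w (e :: _)]/= [take _ (_ :: _)]/= -addrA.
Qed.

Lemma discrepancy_norm ell (w : adversary R n) (B : R) p s : valid_adversary w ->
  0 <= B -> (size s <= p * ell)%N ->
  (forall q rs, (q < p)%N -> all (fun r => 0 <= r.2 <= 1) rs ->
     unzip1 rs = rev (take ell (drop (q * ell) s)) -> `|greedy_disc rs| <= B) ->
  `|discrepancy (phase_greedy ell) w (rev s)| <= p%:R * B.
Proof.
move=> vw B0; elim: p s => [|p IH] s sp sB.
  by move: sp; rewrite leqn0 size_eq0 => /eqP ->; rewrite normr0 mul0r.
pose s0 := take (p * ell) s; pose s1 := drop (p * ell) s.
have s1E : take ell s1 = s1 by rewrite take_oversize // size_drop leq_subLR addnC -mulSn.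
have sE : rev s = rev s1 ++ rev s0 by rewrite -rev_cat cat_take_drop.
have IH0 : `|discrepancy (phase_greedy ell) w (rev s0)| <= p%:R * B.
  apply: IH => [|q rs qp vr E]; first by rewrite size_take_min geq_minl.
  apply: (sB q) => //; first exact: ltnW.
  by rewrite E !take_drop take_takel // -mulSn leq_mul2r qp orbT.
have [ls|gs] := leqP (size s) (p * ell).
  by rewrite -(take_oversize ls) -/s0 (le_trans IH0) // ler_wpM2r // ler_nat leqnSn.
rewrite sE discrepancy_phase; last 2 first.
- by rewrite size_rev /s0 size_takel ?dvdn_mull // ltnW.
- by rewrite size_rev -s1E size_take_min geq_minl.
rewrite -natr1 mulrDl mul1r (le_trans (ler_normD _ _)) // lerD // -sE.
apply: (sB p) => //.
  by have := requests_weight (rev s) vw; rewrite -{1}(cat_take_drop (size (rev s1)) (requests w (rev s))) all_cat => /andP[].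
rewrite -/s1 s1E /unzip1 map_take -/(unzip1 _) unzip1_requests.
by rewrite sE take_size_cat.
Qed.

End Algorithm.

(** * Union bound over submultisets *)

Section Submultiset.
Context (T : eqType).
Implicit Types (f r s : seq T).

Fixpoint submultiset f s : bool :=
  if s is x :: s' then
    if x \in f then submultiset (rem x f) s' else submultiset f s'
  else f == [::].

Lemma submultiset_perm f r s : perm_eq s (f ++ r) -> submultiset f s.
Proof.
elim: s f r => [|x s IH] f r /= p.
  by move: (perm_size p); rewrite size_cat /=; case: f {p}.
case: ifPn => xf.
  apply: (IH _ r); rewrite -(perm_cons x); apply: perm_trans p _.
  by rewrite -cat_cons perm_cat2r perm_to_rem.
have xr : x \in r by have := mem_head x s; rewrite (perm_mem p) mem_cat (negPf xf).
apply: (IH _ (rem x r)); rewrite -(perm_cons x); apply: perm_trans p _.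
by rewrite perm_sym -cat1s perm_catCA perm_cat2l perm_sym perm_to_rem.
Qed.

End Submultiset.

Lemma sum_tuple_cons (R : nmodType) (E : finType) (T : nat) (F : seq E -> R) :
  \sum_(es : T.+1.-tuple E) F es = \sum_x \sum_(es : T.-tuple E) F (x :: es).
Proof.
rewrite pair_bigA /=.
rewrite (reindex (fun p : E * T.-tuple E => [tuple of p.1 :: p.2])) //=.
exists (fun es => (thead es, [tuple of behead es])) => [[x es] _|es _] /=.
  by rewrite theadE; congr (_, _); apply: val_inj.
by rewrite -tuple_eta.
Qed.

Section Probability.
Context (R : realType) (E : finType) (mu : E -> R) (p : R).
Hypotheses (mu0 : forall e, 0 <= mu e) (mu_le : forall e, mu e <= p)
  (mu1 : \sum_e mu e = 1).
Implicit Types (f s : seq E).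

Definition mass (s : seq E) : R := \prod_(e <- s) mu e.

Lemma mass_ge0 s : 0 <= mass s.
Proof. exact: prodr_ge0. Qed.

Lemma total_mass T : \sum_(es : T.-tuple E) mass es = 1.
Proof.
elim: T => [|T IH].
  rewrite (bigD1 [tuple]) //= big1 => [|t]; last by rewrite tuple0.
  by rewrite /mass big_nil addr0.
rewrite (sum_tuple_cons _ mass) -mu1; apply: eq_bigr => e _.
under eq_bigr do rewrite /mass big_cons -/(mass _).
by rewrite -mulr_sumr IH mulr1.
Qed.

Lemma submultiset_prob T a k f :
  \sum_(es : T.-tuple E) (submultiset f (take k (drop a es)))%:R * mass es
    <= (k%:R * p) ^+ size f.
Proof.
have [->|f0] := eqVneq f [::].
  rewrite expr0 -[leRHS](total_mass T); apply: ler_sum => es _.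
  by rewrite ler_piMl ?mass_ge0 // lern1 leq_b1.
have p0 : 0 <= p.
  have [e _|noE] := pickP (@predT E); first exact: le_trans (mu0 e) (mu_le e).
  by move: mu1; rewrite big_pred0 // => /esym /eqP; rewrite oner_eq0.
elim: T a k f f0 => [|T IH] a k f f0.
  rewrite big1 => [|t _]; first by rewrite exprn_ge0 ?mulr_ge0.
  by rewrite tuple0 /= (negPf f0) mul0r.
have IH1 a' k' f' : \sum_(es : T.-tuple E) (submultiset f' (take k' (drop a' es)))%:R * mass es
    <= (k'%:R * p) ^+ size f'.
  have [->|f0'] := eqVneq f' [::]; last exact: IH.
  rewrite expr0 -[leRHS](total_mass T); apply: ler_sum => es _.
  by rewrite ler_piMl ?mass_ge0 // lern1 leq_b1.
rewrite (sum_tuple_cons _ (fun es => (submultiset f (take k (drop a es)))%:R * mass es)).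
case: a => [|a]; last first.
  rewrite -[leRHS]mul1r -[X in _ <= X * _]mu1 mulr_suml; apply: ler_sum => x _.
  apply: le_trans (ler_wpM2l (mu0 x) (IH1 a k f)).
  by rewrite mulr_sumr; apply: ler_sum => es _; rewrite /mass big_cons mulrCA.
case: k => [|k].
  rewrite big1 ?mul0r; first by rewrite exprn_ge0.
  by move=> x _; rewrite big1 // => es _; rewrite take0 /= (negPf f0) mul0r.
pose m := (size f).-1.
have sf : size f = m.+1 by rewrite prednK // lt0n size_eq0.
pose b : R := k%:R * p.
have b0 : 0 <= b by rewrite mulr_ge0.
apply: le_trans (_ : \sum_x (mu x * b ^+ m.+1 + p * b ^+ m *+ (x \in f)) <= _).
  apply: ler_sum => x _.
  under eq_bigr do rewrite drop0 /= /mass big_cons -/(mass _) mulrCA.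
  rewrite -mulr_sumr; case: (boolP (x \in f)) => xf.
    apply: (@le_trans _ _ (mu x * b ^+ m)).
      rewrite ler_wpM2l //; have := IH1 0%N k (rem x f).
      by under eq_bigr do rewrite drop0; rewrite size_rem // sf.
    rewrite mulr1n -[leLHS]add0r lerD ?mulr_ge0 ?exprn_ge0 //.
    by rewrite ler_wpM2r ?exprn_ge0.
  rewrite mulr0n addr0 ler_wpM2l //; have := IH1 0%N k f.
  by under eq_bigr do rewrite drop0; rewrite sf.
rewrite big_split /= -mulr_suml mu1 mul1r.
have -> : \sum_x p * b ^+ m *+ (x \in f) = p * b ^+ m *+ #|f|.
  by rewrite -sumr_const [RHS]big_mkcond; apply: eq_bigr => x _; case: (x \in f).
apply: le_trans (_ : b ^+ m.+1 + p * b ^+ m *+ m.+1 <= _).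
  rewrite lerD2l; apply: ler_wpMn2l; first by rewrite mulr_ge0 ?exprn_ge0.
  by rewrite -sf card_size.
rewrite sf -natr1 mulrDl mul1r -/b.
elim: (m) => [|j IHj]; first by rewrite !expr1 expr0 mulr1.
rewrite [leRHS]exprS; apply: le_trans (ler_wpM2l _ IHj); last by rewrite addr_ge0.
have bj : 0 <= b ^+ j by rewrite exprn_ge0.
rewrite !exprS -(mulr_natr _ j.+1) -(mulr_natr _ j.+2) -[j.+2%:R]natr1.
have : 0 <= p * p * b ^+ j * j.+1%:R by rewrite !mulr_ge0.
set z := b ^+ j; set c := j.+1%:R => H.
rewrite -subr_ge0; apply: le_trans H _; rewrite le_eqVlt; apply/orP; left; apply/eqP; ring.
Qed.

Lemma union_bound T (P : pred (T.-tuple E)) (W : seq (seq E)) (k N : nat) :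
  (forall es : T.-tuple E, ~~ P es -> mass es != 0 ->
     exists q f, [/\ (q < N)%N, f \in W & submultiset f (take k (drop (q * k) es))]) ->
  1 - N%:R * \sum_(f <- W) (k%:R * p) ^+ size f <= \sum_(es | P es) mass es.
Proof.
move=> HW; rewrite lerBlDr -lerBlDl -{1}(total_mass T) (bigID P) /= addrAC subrr add0r.
apply: le_trans (_ : \sum_(es : T.-tuple E) \sum_(q < N) \sum_(f <- W)
    (submultiset f (take k (drop (q * k) es)))%:R * mass es <= _).
  rewrite big_mkcond; apply: ler_sum => es _.
  have ge0 (q : 'I_N) : 0 <= \sum_(f <- W) (submultiset f (take k (drop (q * k) es)))%:R * mass es.
    by apply: sumr_ge0 => f _; rewrite mulr_ge0 ?mass_ge0.
  case: ifPn => nP; last by rewrite sumr_ge0.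
  have [->|m0] := eqVneq (mass es) 0; first by rewrite big1 // => q _; rewrite big1 // => f _; rewrite mulr0.
  have [q [f [qN fW fs]]] := HW es nP m0.
  rewrite (bigD1 (Ordinal qN)) //= -[leLHS]addr0 lerD ?sumr_ge0 //.
  rewrite (big_rem f) //= fs mul1r -[leLHS]addr0 lerD2l sumr_ge0 // => g _.
  by rewrite mulr_ge0 ?mass_ge0.
rewrite exchange_big /= -[N in N%:R]card_ord mulr_natl -sumr_const.
apply: ler_sum => q _; rewrite exchange_big /=; apply: ler_sum => f _.
exact: submultiset_prob.
Qed.

End Probability.

(** * Enumeration of the witnesses *)

Fixpoint words (T : Type) (A : seq T) (X : nat) : seq (seq T) :=
  if X is X'.+1 then [seq a :: s | a <- A, s <- words A X'] else [:: [::]].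

Lemma mem_words (T : eqType) (A s : seq T) : {subset s <= A} -> s \in words A (size s).
Proof.
elim: s => [|a s IH] sA //=.
apply/allpairsP; exists (a, s); split=> //=; first by rewrite sA ?mem_head.
by apply: IH => x xs; rewrite sA // in_cons xs orbT.
Qed.

Lemma size_words (T : Type) (A : seq T) X : size (words A X) = (size A ^ X)%N.
Proof. by elim: X => //= X IH; rewrite size_allpairs IH expnS. Qed.

Lemma size_mem_words (T : eqType) (A s : seq T) X : s \in words A X -> size s = X.
Proof. by elim: X s => [|X IH] s /=; [rewrite inE => /eqP -> | move=> /allpairsP[[a t] [_ /IH <- ->]]]. Qed.

Lemma sum_twice (R : comPzRingType) n (c : R) : \sum_(v < n) c * 2 = 2 * n%:R * c.
Proof. by rewrite sumr_const card_ord -mulr_natr; ring. Qed.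

Section Enumeration.
Context (n : nat) (G : sgraph n).

Definition neighbours (u : 'I_n) : seq 'I_n := enum [set a | G u a].

Fixpoint codes (N : nat) (u : 'I_n) : seq (seq (edge n)) :=
  if N is N'.+1 then
    [::] :: [seq mkedge u a :: s | a <- neighbours u,
               s <- [seq s1 ++ s2 | s1 <- codes N' a, s2 <- codes N' u]]
  else [:: [::]].

Lemma code_mem_codes N u f : code G u f -> (size f <= N)%N -> f \in codes N u.
Proof.
move=> cf; elim: cf N => {u f} [u|u a s1 s2 Gua c1 IH1 c2 IH2] [|N] //= sN.
rewrite ltnS size_cat in sN; rewrite in_cons /=.
apply/allpairsPdep; exists a, (s1 ++ s2); split=> //.
  by rewrite mem_enum inE.
apply/allpairsP; exists (s1, s2); split=> //=.
  by apply: IH1; apply: leq_trans sN; rewrite leq_addr.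
by apply: IH2; apply: leq_trans sN; rewrite leq_addl.
Qed.

(* If [S] bounds the sums of depth [N], those of depth [N+1] are at most
   [1 + Delta y S^2], and [S = 2] is preserved. *)
Lemma sum_codes (R : realType) Delta (y : R) N u : regular G Delta -> 0 <= y ->
  4 * Delta%:R * y <= 1 -> \sum_(f <- codes N u) y ^+ size f <= 2.
Proof.
move=> reg y0 Dy; elim: N u => [|N IH] u; first by rewrite big_seq1 expr0; lra.
have sum0 v : 0 <= \sum_(f <- codes N v) y ^+ size f.
  by apply: sumr_ge0 => f _; rewrite exprn_ge0.
rewrite big_cons expr0 big_allpairs_dep /=.
apply: le_trans (_ : 1 + \sum_(a <- neighbours u) y * 4 <= _).
  rewrite lerD2l; apply: ler_sum => a _.
  rewrite big_allpairs_dep /=.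
  under eq_bigr => s1 _ do (under eq_bigr => s2 _ do rewrite exprS size_cat exprD mulrA).
  under eq_bigr => s1 _ do rewrite -mulr_sumr.
  rewrite -mulr_suml -mulr_sumr -mulrA ler_wpM2l //.
  rewrite [4](_ : _ = 2 * 2); last by rewrite -natrM.
  by apply: ler_pM.
rewrite big_const_seq iter_addr addr0.
have -> : count predT (neighbours u) = Delta.
  by rewrite count_predT -cardE reg.
rewrite -mulr_natr; lra.
Qed.

Definition inner_edges (u : 'I_n) (f : seq (edge n)) : seq (edge n) :=
  [seq (a, b) | a <- enum (vset u f), b <- enum (vset u f)].

Lemma mem_inner_edges u f e : e.1 \in vset u f -> e.2 \in vset u f -> e \in inner_edges u f.
Proof.
move=> e1 e2; apply/allpairsP; exists e; rewrite !mem_enum; split=> //; exact: surjective_pairing.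
Qed.

Lemma card_vset (u : 'I_n) (f : seq (edge n)) : (#|vset u f| <= (2 * size f).+1)%N.
Proof.
elim: f => [|e f IH]; first by rewrite vset_nil cards1.
have sub : vset u (e :: f) \subset e.1 |: (e.2 |: vset u f).
  apply/fintype.subsetP => x; rewrite !in_setU1 !mem_vset /= /incident.
  by case: (x == u); case: (x == e.1); case: (x == e.2).
apply: leq_trans (subset_leq_card sub) _; rewrite !cardsU1 /=.
by move: IH; case: (_ \notin _); case: (_ \notin _); rewrite /=; lia.
Qed.

Definition large_witnesses (N M : nat) : seq (seq (edge n)) :=
  [seq f | v <- enum 'I_n, f <- [seq f <- codes N v | (M <= size f)%N]].

Definition dense_witnesses (N M X : nat) : seq (seq (edge n)) :=
  [seq f | v <- enum 'I_n, f <- [seq f ++ x | f <- [seq f <- codes N v | (size f < M)%N],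
                                              x <- words (inner_edges v f) X]].

Context (R : realType) (Delta : nat) (y0 : R).
Hypotheses (reg : regular G Delta) (y0_ge0 : 0 <= y0) (Dy0 : 8 * Delta%:R * y0 <= 1).

Lemma sum_large_witnesses N M :
  \sum_(f <- large_witnesses N M) y0 ^+ size f <= 2 * n%:R * 2^-1 ^+ M.
Proof.
have y0' : 0 <= 2 * y0 by rewrite mulr_ge0.
have Dy : 4 * Delta%:R * (2 * y0) <= 1 by move: Dy0; lra.
rewrite big_allpairs_dep /= big_enum /=.
apply: le_trans (_ : \sum_(v : 'I_n) 2^-1 ^+ M * 2 <= _); last by rewrite sum_twice.
apply: ler_sum => v _; rewrite big_filter.
apply: le_trans (ler_wpM2l _ (sum_codes N v reg y0' Dy)); last by rewrite exprn_ge0 // invr_ge0.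
rewrite mulr_sumr big_mkcond; apply: ler_sum => f _.
case: ifP => [Mf|_]; last by rewrite mulr_ge0 ?exprn_ge0 // invr_ge0.
rewrite -{1}[y0](mulKf (_ : 2 != 0)) // exprMn ler_wpM2r ?exprn_ge0 //.
by apply: ler_wiXn2l => //; rewrite ?invr_ge0 ?invf_le1 ?ler1n.
Qed.

Lemma sum_dense_witnesses N M X :
  \sum_(f <- dense_witnesses N M X) y0 ^+ size f <= 2 * n%:R * (4 * M%:R ^+ 2 * y0) ^+ X.
Proof.
have D0 : 0 <= Delta%:R * y0 by rewrite mulr_ge0.
have Dy : 4 * Delta%:R * y0 <= 1 by move: Dy0; lra.
set c := (4 * M%:R ^+ 2 * y0) ^+ X.
have c0 : 0 <= c by rewrite exprn_ge0 // !mulr_ge0.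
rewrite big_allpairs_dep /= big_enum /=.
apply: le_trans (_ : \sum_(v : 'I_n) c * 2 <= _); last by rewrite sum_twice.
apply: ler_sum => v _; rewrite big_allpairs_dep /= big_filter.
apply: le_trans (ler_wpM2l c0 (sum_codes N v reg y0_ge0 Dy)).
rewrite mulr_sumr big_mkcond; apply: ler_sum => f _.
case: ifP => [fM|_]; last by rewrite mulr_ge0 ?(exprn_ge0 _ y0_ge0).
rewrite (eq_big_seq (fun=> y0 ^+ size f * y0 ^+ X)); last first.
  by move=> x /size_mem_words xX; rewrite size_cat xX exprD.
rewrite big_const_seq iter_addr addr0 count_predT size_words.
set N' := (_ ^ X)%N.
have -> : y0 ^+ size f * y0 ^+ X *+ N' = N'%:R * y0 ^+ X * y0 ^+ size f.
  by rewrite -mulr_natr; ring.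
rewrite ler_wpM2r ?exprn_ge0 // natrX -exprMn lerXn2r ?nnegrE ?mulr_ge0 // ler_wpM2r //.
rewrite -natrX -natrM ler_nat size_allpairs -!cardE.
have le2 : (#|vset v f| <= 2 * M)%N.
  apply: leq_trans (card_vset v f) _; apply: leq_trans (_ : 2 * (size f).+1 <= _)%N.
    by rewrite mulnS addSn ltnS leq_addl.
  by rewrite leq_mul2l fM.
by apply: leq_trans (leq_mul le2 le2) _; rewrite mulnACA mulnn.
Qed.

End Enumeration.

(** * Failure probability *)

Lemma row_norm_le (R : realType) n (d : 'rV[R]_n) (B : R) : 0 <= B ->
  (forall u, `|d 0 u| <= B) -> `|d| <= B.
Proof.
move=> B0 dB; rewrite [leLHS]mx_normrE; apply: bigmax_le => // -[i j] _ /=.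
by rewrite ord1.
Qed.

Lemma handshake n (G : sgraph n) Delta : regular G Delta -> (2 * #|edges G| = n * Delta)%N.
Proof.
move=> reg.
have -> : (n * Delta = #|[set e : edge n | G e.1 e.2]|)%N.
  rewrite -sum1_card (eq_bigl (fun e : edge n => predT e.1 && G e.1 e.2)); last by move=> e; rewrite inE.
  rewrite -(pair_big_dep predT (fun i j => G i j) (fun _ _ => 1%N)) /=.
  have regE i : (\sum_(j | G i j) 1 = Delta)%N.
    by rewrite -(reg i) -sum1_card; apply: eq_bigl => u; rewrite inE.
  by rewrite (eq_bigr (fun=> Delta)) ?sum_nat_const ?card_ord.
rewrite -[RHS](cardsID (edges G)) mul2n -addnn; congr (_ + _)%N.
  by apply: eq_card => e; rewrite !inE; case: (G _ _); rewrite ?andbF ?andbT.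
have swap_inj : injective (fun e : edge n => (e.2, e.1) : edge n) by move=> [a b] [c d] [-> ->].
rewrite -(card_imset (edges G) swap_inj).
apply: eq_card => e; rewrite !inE; apply/imsetP/idP => [[[i j]]|].
  rewrite inE /= => /andP[ij Gij] -> /=.
  by rewrite adj_sym Gij ltnNge ltnW //= andbT.
move=> /andP[ne Ge]; exists (e.2, e.1); last by case: (e).
rewrite inE /= adj_sym Ge andbT ltn_neqAle.
move: ne; rewrite Ge andbT -leqNgt => ->; rewrite andbT.
by apply: contraTneq Ge => E; rewrite (val_inj E) adj_irr.
Qed.

Section Phases.
Context (R : realType) (n : nat) (G : sgraph n) (Delta T N : nat) (w : adversary R n).
Hypotheses (n16 : (16 <= n)%N) (Delta1 : (1 <= Delta)%N) (reg : regular G Delta)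
  (TN : (T <= N * (n %/ 16))%N) (vw : valid_adversary w).

Let ell : nat := n %/ 16.
Let p : R := #|edges G|%:R^-1.

Lemma card_edges_gt0 : (0 < #|edges G|)%N.
Proof. by have := handshake reg; case: #|edges G| => // /esym; case: n n16 Delta1 => // m _; case: Delta. Qed.

Lemma uniform_edge_le e : uniform_edge R G e <= p.
Proof. by rewrite /uniform_edge; case: ifP => // _; rewrite invr_ge0. Qed.

Lemma uniform_edge_ge0 e : 0 <= uniform_edge R G e.
Proof. by rewrite /uniform_edge; case: ifP => // _; rewrite invr_ge0. Qed.

Lemma sum_uniform_edge : \sum_e uniform_edge R G e = 1.
Proof.
rewrite -big_mkcond sumr_const -[LHS]mulr_natr mulVf //.
by rewrite pnatr_eq0 -lt0n card_edges_gt0.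
Qed.

Lemma phase_rate_ge0 : 0 <= ell%:R * p.
Proof. by rewrite mulr_ge0 // invr_ge0. Qed.

Lemma phase_rate : 8 * Delta%:R * (ell%:R * p) <= 1.
Proof.
have E0 : 0 < #|edges G|%:R :> R by rewrite ltr0n card_edges_gt0.
rewrite /p mulrA ler_pdivrMr // mul1r -!natrM ler_nat.
rewrite -(leq_pmul2l (ltn0Sn 1)) (handshake reg) mulnA mulnA mulnAC.
by rewrite leq_mul2r mulnC leq_trunc_div orbT.
Qed.

Lemma mass_edges (es : seq (edge n)) : mass (uniform_edge R G) es != 0 ->
  {subset es <= edges G}.
Proof.
rewrite /mass prodf_seq_neq0 => /allP H e /H /=; rewrite /uniform_edge.
by case: ifP => //; rewrite eqxx.
Qed.

Lemma iid_probE (P : pred (T.-tuple (edge n))) :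
  iid_prob R G T P = \sum_(es | P es) mass (uniform_edge R G) es.
Proof. by apply: eq_bigr => es _; rewrite /mass big_tuple. Qed.

Lemma bad_phase (B : R) (es : T.-tuple (edge n)) : 0 <= B -> {subset es <= edges G} ->
  ~~ (max_discrepancy (phase_greedy ell) w es <= N%:R * B) ->
  exists q rs D v, [/\ (q < N)%N, valid_requests rs /\ {subset unzip1 rs <= edges G},
    exists r, perm_eq (take ell (drop (q * ell) es)) (unzip1 rs ++ r),
    greedy_process D & B < D rs v].
Proof.
move=> B0 esG big.
apply: contrapT => noq; move/negP: big; apply.
apply: bigmax_le => [|t _]; first by rewrite mulr_ge0.
apply: discrepancy_norm => // [|q rs qN wr E].
  by rewrite size_take_min size_tuple (leq_trans (geq_minr _ _)).
have [r pr] : exists r, take ell (drop (q * ell) es) = take ell (drop (q * ell) (take t es)) ++ r.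
  rewrite !take_drop takeC; set z := take (ell + _) es.
  rewrite -{1}(cat_take_drop t z) drop_cat.
  case: ltnP => [_|tq]; first by exists (drop t z).
  by rewrite (drop_oversize tq); eexists.
have pr' : perm_eq (take ell (drop (q * ell) es)) (unzip1 rs ++ r).
  by rewrite pr perm_cat2r E perm_sym perm_rev.
have rsG : {subset unzip1 rs <= edges G}.
  move=> e er; apply: esG; have : e \in take ell (drop (q * ell) es).
    by rewrite (perm_mem pr') mem_cat er.
  by move=> /mem_take /mem_drop.
have vr : valid_requests rs.
  apply/allP => x xr; rewrite (allP wr x xr) /=.
  have /rsG : x.1 \in unzip1 rs by apply: map_f.
  by rewrite inE => /andP[+ _]; apply: contraTneq => ->; rewrite ltnn.
apply: row_norm_le => // v; rewrite leNgt; apply/negP => Bv; apply: noq.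
have [d0|d0] := leP 0 (greedy_disc rs 0 v).
- exists q, rs, (fun rs u => greedy_disc rs 0 u), v; split=> //.
  + by exists r.
  + exact: greedy_disc_process.
  + by move: Bv; rewrite ger0_norm.
- exists q, rs, (fun rs u => - greedy_disc rs 0 u), v; split=> //.
  + by exists r.
  + exact/greedy_process_opp/greedy_disc_process.
  + by move: Bv; rewrite ltr0_norm.
Qed.

Lemma window_witness (es f r s s' : seq (edge n)) q :
  perm_eq (take ell (drop (q * ell) es)) (s ++ r) -> perm_eq s (f ++ s') ->
  (size f <= ell)%N /\ submultiset f (take ell (drop (q * ell) es)).
Proof.
move=> p1 p2.
have p3 : perm_eq (take ell (drop (q * ell) es)) (f ++ (s' ++ r)).
  by rewrite (permPl p1) catA perm_cat2r.
split; last exact: submultiset_perm p3.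
have := perm_size p3; rewrite size_cat => sE.
by apply: leq_trans (leq_addr (size (s' ++ r)) _) _; rewrite -sE size_take_min geq_minl.
Qed.

Lemma prob_large M K : (3 * M <= K ^ 3)%N ->
  1 - N%:R * (2 * n%:R * 2^-1 ^+ M) <=
  iid_prob R G T (fun es => max_discrepancy (phase_greedy ell) w es <= N%:R * (3 * K%:R)).
Proof.
move=> MK; rewrite iid_probE.
apply: le_trans (union_bound uniform_edge_ge0 uniform_edge_le sum_uniform_edge
  (W := large_witnesses G ell M) (k := ell) (N := N) _); last first.
  move=> es bad /mass_edges esG.
  have [|q [rs [D [v [qN [vr rsG] [r pr] gD BD]]]]] := bad_phase _ esG bad.
    by rewrite mulr_ge0.
  have [|f [cf [r' pf] Kf]] := large_code gD vr rsG (K := K) (v := v).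
    by apply: ltW; apply: le_lt_trans BD; rewrite gerBl.
  have [fl fs] := window_witness pr pf.
  exists q, f; split=> //; apply/allpairsPdep; exists v, f; split=> //.
    by rewrite mem_enum.
  by rewrite mem_filter code_mem_codes // andbT -(leq_pmul2l (ltn0Sn 2)) (leq_trans MK).
rewrite lerD2l lerN2 ler_wpM2l //.
by apply: (sum_large_witnesses reg phase_rate_ge0 phase_rate).
Qed.

Lemma prob_dense M X J K : (M <= 2 ^ J)%N -> (0 < K)%N -> (6 * X <= K ^ 3)%N ->
  1 - N%:R * (2 * n%:R * 2^-1 ^+ M + 2 * n%:R * (4 * M%:R ^+ 2 * (ell%:R * p)) ^+ X) <=
  iid_prob R G T (fun es => max_discrepancy (phase_greedy ell) w es <=
    N%:R * (9 * J.+1%:R + 3 * K%:R)).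
Proof.
move=> MJ K0 XK; rewrite iid_probE.
apply: le_trans (union_bound uniform_edge_ge0 uniform_edge_le sum_uniform_edge
  (W := large_witnesses G ell M ++ dense_witnesses G ell M X) (k := ell) (N := N) _); last first.
  move=> es bad /mass_edges esG.
  have [|q [rs [D [v [qN [vr rsG] [r pr] gD BD]]]]] := bad_phase _ esG bad.
    by rewrite addr_ge0 // mulr_ge0.
  have [[f [s' [cf pf Mf]]]|small] := pselect (exists f s', [/\ code G v f,
      perm_eq (unzip1 rs) (f ++ s') & (M <= size f)%N]).
    have [fl fs] := window_witness pr pf.
    exists q, f; split=> //; rewrite mem_cat; apply/orP; left.
    apply/allpairsPdep; exists v, f; split=> //; first by rewrite mem_enum.
    by rewrite mem_filter Mf code_mem_codes.
  have small' f s' : code G v f -> perm_eq (unzip1 rs) (f ++ s') -> (size f < M)%N.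
    by move=> cf pf; rewrite ltnNge; apply/negP => Mf; apply: small; exists f, s'.
  have [||f [x [cf xC [r' pf] Kx]]] := dense_code gD vr rsG (v := v) (J := J) K0.
  - by apply: ltW; apply: le_lt_trans BD; rewrite gerBl.
  - by move=> f s' cf pf; apply: leq_trans (small' f s' cf pf) MJ.
  have Xx : (X <= size x)%N by rewrite -(leq_pmul2l (ltn0Sn 5)) (leq_trans XK).
  have pf' : perm_eq (unzip1 rs) ((f ++ take X x) ++ (drop X x ++ r')).
    by rewrite -!catA [take X x ++ _]catA cat_take_drop.
  have [fl fs] := window_witness pr pf'.
  exists q, (f ++ take X x); split=> //; rewrite mem_cat; apply/orP; right.
  apply/allpairsPdep; exists v, (f ++ take X x); split=> //; first by rewrite mem_enum.
  apply/allpairsPdep; exists f, (take X x); split=> //.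
    rewrite mem_filter (small' _ _ cf pf) code_mem_codes //.
    by apply: leq_trans fl; rewrite size_cat leq_addr.
  rewrite -{2}(size_takel Xx); apply: mem_words => e /mem_take /xC /andP[e1 e2].
  exact: mem_inner_edges.
rewrite lerD2l lerN2 ler_wpM2l // big_cat lerD //.
  by apply: (sum_large_witnesses reg phase_rate_ge0 phase_rate).
by apply: (sum_dense_witnesses reg phase_rate_ge0 phase_rate).
Qed.

End Phases.

(** * Numerical estimates *)

Section Numeric.
Context (R : realType).
Implicit Types a b x y : R.

Lemma cube_powR_third x : 0 <= x -> (x `^ 3^-1) ^+ 3 = x.
Proof.
by move=> x0; rewrite -powR_mulrn ?powR_ge0 // -powRrM mulVf // powRr1.
Qed.

Lemma powR_third_le x y : 0 <= x -> 0 <= y -> x <= y ^+ 3 -> x `^ 3^-1 <= y.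
Proof.
by move=> x0 y0 xy; rewrite -(@ler_pXn2r _ 3) ?nnegrE ?powR_ge0 // cube_powR_third.
Qed.

Lemma nat_cube_root x : 0 <= x ->
  exists k : nat, [/\ (0 < k)%N, x <= k%:R ^+ 3 & k%:R <= x `^ 3^-1 + 1].
Proof.
move=> x0; exists (Num.truncn (x `^ 3^-1)).+1; split=> //.
  rewrite -{1}(cube_powR_third x0) lerXn2r ?nnegrE ?powR_ge0 //.
  exact/ltW/truncnS_gt.
by rewrite -natr1 lerD2r truncn_le powR_ge0.
Qed.

Lemma ln2_ge_half : 2^-1 <= ln 2 :> R.
Proof.
have := @le_ln1Dx R (- 2^-1); have -> : 1 + - 2^-1 = 2^-1 :> R by lra.
rewrite lnV ?posrE // => /(_ _); rewrite lerN2; apply; lra.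
Qed.

Lemma up_log2_le (m : nat) : (1 < m)%N -> (up_log 2 m)%:R <= 1 + 2 * ln m%:R :> R.
Proof.
move=> m1; have := up_log_gtn (isT : 1 < 2)%N m1.
have : (0 < up_log 2 m)%N by rewrite up_log_gt0 m1.
case: (up_log 2 m) => // u _ /= lt.
have : ln (2 ^+ u) <= ln m%:R :> R.
  rewrite ler_ln ?posrE ?exprn_gt0 ?ltr0n ?(ltnW m1) //.
  by rewrite -natrX ler_nat ltnW.
rewrite lnXn // -[_ *+ u]mulr_natr -natr1 => le.
have : 2^-1 * u%:R <= ln 2 * u%:R :> R by rewrite ler_wpM2r // ln2_ge_half.
lra.
Qed.

Lemma half_pow_le (n : nat) : (0 < n)%N ->
  2^-1 ^+ (3 * up_log 2 n) <= (n%:R ^+ 3)^-1 :> R.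
Proof.
move=> n0; rewrite exprVn lef_pV2 ?posrE ?exprn_gt0 ?ltr0n //.
by rewrite -!natrX ler_nat mulnC expnM leq_exp2r // up_logP.
Qed.

Lemma failure_le (n N : nat) a b : (0 < n)%N -> (4 * N <= n)%N ->
  a <= (n%:R ^+ 3)^-1 -> b <= (n%:R ^+ 3)^-1 ->
  1 - n%:R `^ (- 1) <= 1 - N%:R * (2 * n%:R * a + 2 * n%:R * b).
Proof.
move=> n0 Nn an bn; rewrite lerD2l lerN2 powR_inv1 //.
have n0' : 0 < n%:R :> R by rewrite ltr0n.
apply: le_trans (_ : N%:R * (4 * n%:R * (n%:R ^+ 3)^-1) <= _).
  rewrite ler_wpM2l // -mulrDr (_ : 4 * _ * _ = 2 * n%:R * ((n%:R ^+ 3)^-1 + (n%:R ^+ 3)^-1)).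
    by rewrite ler_wpM2l ?mulr_ge0 // lerD.
  by ring.
have Nn' : 4 * N%:R <= n%:R :> R by rewrite -natrM ler_nat.
have -> : N%:R * (4 * n%:R * (n%:R ^+ 3)^-1) = 4 * N%:R * n%:R^-1 * n%:R^-1 :> R.
  by field; rewrite gt_eqF.
rewrite -[leRHS]mul1r ler_wpM2r ?invr_ge0 // ler_pdivrMr // mul1r //.
Qed.

Lemma horizon_le (K : R) (n T : nat) : 0 < K -> (16 <= n)%N -> T%:R <= K * n%:R ->
  (T <= (Num.truncn (32 * K)).+1 * (n %/ 16))%N.
Proof.
move=> K0 n16 TK; rewrite -(ler_nat R) natrM.
apply: le_trans TK _; have n32 : n%:R <= 32 * (n %/ 16)%:R :> R.
  by rewrite -natrM ler_nat; lia.
apply: (@le_trans _ _ (32 * K * (n %/ 16)%:R)).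
  by rewrite mulrAC [leRHS]mulrC ler_wpM2l // ltW.
by rewrite ler_wpM2r // ltW // truncnS_gt.
Qed.

Lemma ln_ge a (n : nat) : (Num.truncn (expR a) < n)%N -> a <= ln n%:R.
Proof.
move=> an; rewrite -[leLHS]expRK ler_ln ?posrE ?expR_gt0 ?ltr0n ?(leq_ltn_trans _ an) //.
by apply: le_trans (ltW (truncnS_gt _)) _; rewrite ler_nat.
Qed.

Lemma up_log3_le (n : nat) : 1 <= ln n%:R :> R -> (3 * up_log 2 n)%:R <= 9 * ln n%:R :> R.
Proof.
move=> ln1; have n1 : (1 < n)%N.
  rewrite ltnNge; apply/negP => n1; have : ln n%:R <= 0 :> R by rewrite ln_le0 // lern1.
  by move: ln1; lra.
by rewrite natrM; have := up_log2_le n1; lra.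
Qed.

Lemma up_log_up_log_le (n : nat) : 1 <= ln n%:R :> R -> 1 <= ln (ln n%:R) :> R ->
  9 * (up_log 2 (3 * up_log 2 n)).+1%:R <= 180 * ln (ln n%:R) :> R.
Proof.
move=> l1 l2; have M9 := up_log3_le l1.
set M := (3 * _)%N in M9 *.
have M1 : (1 < M)%N.
  rewrite /M; suff : (0 < up_log 2 n)%N by case: up_log => // k _; rewrite mulnS.
  rewrite up_log_gt0 /= ltnNge; apply/negP => n1; have : ln n%:R <= 0 :> R by rewrite ln_le0 // lern1.
  by move: l1; lra.
have lnM' : ln M%:R <= ln 9 + ln (ln n%:R) :> R.
  by rewrite -lnM ?posrE // ?ler_ln ?posrE ?mulr_gt0 ?ltr0n ?(ltnW M1) //; move: l1; lra.
have ln9 : ln 9 <= 8 :> R.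
  have := @le_ln1Dx R 8; have -> : 1 + 8 = 9 :> R by lra.
  by apply; lra.
by rewrite -natr1; have := up_log2_le M1; lra.
Qed.

Lemma excess_probability_le (c : R) (n Delta M X : nat) (y0 : R) : (0 < n)%N -> 0 < c -> 0 <= y0 ->
  8 * Delta%:R * y0 <= 1 -> c * ln n%:R ^+ 3 <= Delta%:R -> 1 <= ln n%:R :> R ->
  M%:R <= 9 * ln n%:R :> R -> 9 ^+ 12 / c ^+ 5 <= ln n%:R -> 1 < Delta%:R :> R ->
  18 * ln n%:R <= X%:R * ln Delta%:R :> R ->
  (4 * M%:R ^+ 2 * y0) ^+ X <= (n%:R ^+ 3)^-1.
Proof.
move=> n0 c0 y00 Dy D3 l1 M9 l9 D1 lX.
have n0' : 0 < n%:R :> R by rewrite ltr0n.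
set L := ln n%:R in D3 l1 M9 l9 lX; set d : R := Delta%:R in Dy D3 D1 lX *.
have d0 : 0 < d by lra.
have L0 : 0 < L by lra.
set z := 4 * _ * y0.
have z0 : 0 <= z by rewrite !mulr_ge0.
have zd : 2 * d * z <= M%:R ^+ 2.
  have -> : 2 * d * z = 8 * d * y0 * M%:R ^+ 2 by rewrite /z; ring.
  by rewrite -[leRHS]mul1r ler_wpM2r ?exprn_ge0.
clearbody z; have dz0 : 0 <= 2 * d * z by rewrite !mulr_ge0 // ltW.
have zd6 : 64 * d ^+ 6 * z ^+ 6 <= 9 ^+ 12 * L ^+ 12.
  have -> : 64 * d ^+ 6 * z ^+ 6 = (2 * d * z) ^+ 6 by ring.
  apply: le_trans (_ : (M%:R ^+ 2) ^+ 6 <= _).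
    by rewrite lerXn2r ?nnegrE ?exprn_ge0.
  by rewrite -exprM -exprMn lerXn2r ?nnegrE ?mulr_ge0 // (ltW L0).
have Ld : c ^+ 4 * L ^+ 12 <= d ^+ 4.
  rewrite -[12%N]/(3 * 4)%N exprM -exprMn lerXn2r ?nnegrE // ?(ltW d0) //.
  by rewrite mulr_ge0 ?exprn_ge0 // ltW.
have Ld1 : c * L <= d.
  apply: le_trans D3; rewrite ler_pM2l // exprS -[leLHS]mulr1 ler_pM2l //.
  by rewrite exprn_ege1.
have z6 : d * z ^+ 6 <= 1.
  have c5 : 9 ^+ 12 <= c ^+ 5 * L by move: l9; rewrite ler_pdivrMr ?exprn_gt0 // mulrC.
  have c4 : 9 ^+ 12 <= c ^+ 4 * d.
    apply: le_trans c5 _; rewrite exprSr -mulrA ler_pM2l ?exprn_gt0 //.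
  have : c ^+ 4 * (64 * d ^+ 6 * z ^+ 6) <= c ^+ 4 * d * d ^+ 4.
    apply: le_trans (_ : 9 ^+ 12 * (c ^+ 4 * L ^+ 12) <= _).
      by rewrite [leRHS]mulrCA ler_pM2l ?exprn_gt0.
    apply: ler_pM; rewrite ?exprn_ge0 // mulr_ge0 ?exprn_ge0 ?(ltW c0) ?(ltW L0) //.
  have -> : c ^+ 4 * (64 * d ^+ 6 * z ^+ 6) = (c ^+ 4 * d ^+ 5) * (64 * (d * z ^+ 6)) by ring.
  have -> : c ^+ 4 * d * d ^+ 4 = (c ^+ 4 * d ^+ 5) * 1 by ring.
  rewrite ler_pM2l ?mulr_gt0 ?exprn_gt0 // => H.
  have : 0 <= d * z ^+ 6 by rewrite mulr_ge0 ?exprn_ge0 // ltW.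
  move: H; lra.
have zX0 : 0 <= z ^+ X by rewrite exprn_ge0.
rewrite -(@ler_pXn2r _ 6) ?nnegrE ?invr_ge0 ?exprn_ge0 ?(ltW n0') //.
have -> : (z ^+ X) ^+ 6 = (z ^+ 6) ^+ X by rewrite -!exprM mulnC.
rewrite exprVn -(ler_pM2l (exprn_gt0 X d0)) -exprMn.
apply: le_trans (_ : 1 <= _).
  by rewrite exprn_ile1 // mulr_ge0 ?exprn_ge0 // ltW.
rewrite ler_pdivlMr ?exprn_gt0 // mul1r -ler_ln ?posrE ?exprn_gt0 //.
by rewrite !lnXn ?exprn_gt0 // -/L -mulrnA -[L *+ _]mulr_natl -[_ *+ X]mulr_natl.
Qed.

End Numeric.

Theorem theorem1p2 (R : realType) (K : R) (K_gt0 : 0 < K) :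
  exists A : forall n : nat, sgraph n -> nat -> algorithm R n,
    (exists (C gamma : R) (n0 : nat),
      [/\ 0 < C, 0 < gamma, (0 < n0)%N &
        forall (n Delta : nat) (G : sgraph n) (T : nat) (w : adversary R n),
          (n0 <= n)%N -> (1 <= Delta)%N -> regular G Delta ->
          T%:R <= K * n%:R ->
          valid_adversary w ->
          1 - n%:R `^ (- gamma) <=
            iid_prob R G T (fun es =>
              max_discrepancy (A n G T) w es <= C * (ln n%:R) `^ (3^-1))])
    /\
    (forall c : R, 0 < c ->
      exists (C gamma : R) (n0 : nat),
      [/\ 0 < C, 0 < gamma, (0 < n0)%N &
        forall (n Delta : nat) (G : sgraph n) (T : nat) (w : adversary R n),
          (n0 <= n)%N -> (1 <= Delta)%N -> regular G Delta ->
          c * (ln n%:R) ^+ 3 <= Delta%:R ->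
          T%:R <= K * n%:R ->
          valid_adversary w ->
          1 - n%:R `^ (- gamma) <=
            iid_prob R G T (fun es =>
              max_discrepancy (A n G T) w es <=
                C * ((ln n%:R / ln Delta%:R) `^ (3^-1) + ln (ln n%:R)))]).
Proof.
exists (fun n _ _ => phase_greedy (n %/ 16)).
pose N := (Num.truncn (32 * K)).+1.
have N0 : 0 < N%:R :> R by rewrite ltr0n.
pose n0 (a : R) := (16 + 4 * N + Num.truncn (expR a)).+1.
have n0P a n : (n0 a <= n)%N -> [/\ (16 <= n)%N, (4 * N <= n)%N & a <= ln n%:R].
  by rewrite /n0 => nn; split; [lia | lia | apply: ln_ge; lia].
have iid_mono n (G : sgraph n) T (w : adversary R n) (a b : R) A : a <= b ->
    iid_prob R G T (fun es => max_discrepancy A w es <= a) <=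
    iid_prob R G T (fun es => max_discrepancy A w es <= b).
  move=> ab; rewrite !iid_probE [leLHS]big_mkcond [leRHS]big_mkcond; apply: ler_sum => es _.
  have m0 : 0 <= mass (uniform_edge R G) es by apply: mass_ge0 => e; apply: uniform_edge_ge0.
  case: ifP => [/le_trans/(_ ab) ->//|_]; by case: ifP.
split.
- exists (12 * N%:R), 1, (n0 1); split; rewrite ?mulr_gt0 // => n Delta G T w /n0P[n16 nN l1] D1 reg TK vw.
  have TN := horizon_le K_gt0 n16 TK.
  have ng0 : (0 < n)%N by apply: leq_trans n16.
  set M := (3 * up_log 2 n)%N.
  have M0 : 0 <= (3 * M)%:R :> R by [].
  have [k [k0 Mk kM]] := nat_cube_root M0.
  have kb : k%:R <= 4 * ln n%:R `^ 3^-1 :> R.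
    have one : 1 `^ 3^-1 = 1 :> R by rewrite powR1.
    have s1 : 1 <= ln n%:R `^ 3^-1 :> R.
      by rewrite -[leLHS]one; apply: ge0_ler_powR; rewrite ?nnegrE ?invr_ge0 //; lra.
    have : (3 * M)%:R `^ 3^-1 <= 3 * ln n%:R `^ 3^-1 :> R.
      apply: powR_third_le => //; first by lra.
      rewrite exprMn cube_powR_third; last by lra.
      by rewrite natrM -natrX; have := up_log3_le l1; rewrite -/M; lra.
    by move: kM; lra.
  have Mk' : (3 * M <= k ^ 3)%N by rewrite -(ler_nat R) natrX.
  apply: le_trans (iid_mono _ _ _ _ _ _ _ _).
    apply: le_trans (prob_large n16 D1 reg TN vw Mk').
    have := failure_le ng0 nN (half_pow_le R ng0) (_ : 0 <= _); rewrite mulr0 addr0; apply.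
    by rewrite invr_ge0 exprn_ge0.
  by rewrite [12 * _]mulrC -mulrA ler_wpM2l //; move: kb; lra.
- move=> c c0; pose a := expR 1 + 9 ^+ 12 / c ^+ 5 + 2 / c.
  exists (189 * N%:R), 1, (n0 a); split; rewrite ?mulr_gt0 // => n Delta G T w /n0P[n16 nN la] D1 reg D3 TK vw.
  have TN := horizon_le K_gt0 n16 TK.
  have ng0 : (0 < n)%N by apply: leq_trans n16.
  have a1 : 0 <= 9 ^+ 12 / c ^+ 5 by rewrite divr_ge0 ?exprn_ge0 // ltW.
  have a2 : 0 < 2 / c by rewrite divr_gt0.
  have e1 : 1 + 1 <= expR 1 :> R by apply: expR_ge1Dx.
  have l1 : 1 <= ln n%:R :> R by move: la; rewrite /a; lra.
  have l2 : 1 <= ln (ln n%:R) :> R.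
    rewrite -[leLHS](@expRK R) ler_ln ?posrE ?expR_gt0 //; last by lra.
    by move: la; rewrite /a; lra.
  have DD : 2 <= Delta%:R :> R.
    apply: le_trans D3; have : 2 / c <= ln n%:R by move: la; rewrite /a; lra.
    rewrite ler_pdivrMr // mulrC => /le_trans; apply; rewrite ler_pM2l //.
    by rewrite exprS -[leLHS]mulr1 ler_pM2l ?exprn_ege1 //; lra.
  have lD : 0 < ln Delta%:R :> R by apply: ln_gt0; lra.
  set M := (3 * up_log 2 n)%N; set J := up_log 2 M.
  pose u := ln n%:R / ln Delta%:R : R.
  have u0 : 0 <= u by rewrite divr_ge0 // ?ltW //; lra.
  pose X := (Num.truncn (18 * u)).+1.
  have X1 : X%:R <= 18 * u + 1 by rewrite /X -[leLHS]natr1 lerD2r truncn_le mulr_ge0.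
  have X2 : 18 * u <= X%:R by apply/ltW/truncnS_gt.
  have X0 : 0 <= (6 * X)%:R :> R by [].
  have [k [k0 Xk kX]] := nat_cube_root X0.
  have s0 : 0 <= u `^ 3^-1 by apply: powR_ge0.
  have kb : k%:R <= 5 * u `^ 3^-1 + 3.
    suff : (6 * X)%:R `^ 3^-1 <= 5 * u `^ 3^-1 + 2 by move: kX; lra.
    apply: powR_third_le => //; first by lra.
    apply: (@le_trans _ _ (125 * u + 8)); first by rewrite natrM; lra.
    rewrite -{1}(cube_powR_third u0); move: (u `^ 3^-1) s0 => s s0.
    rewrite -subr_ge0 (_ : _ - _ = 150 * (s * s) + 60 * s); last by ring.
    by rewrite addr_ge0 ?mulr_ge0.
  have Xk' : (6 * X <= k ^ 3)%N by rewrite -(ler_nat R) natrX.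
  have MJ : (M <= 2 ^ J)%N by apply: up_logP.
  apply: le_trans (iid_mono _ _ _ _ _ _ _ _).
    apply: le_trans (prob_dense n16 D1 reg TN vw MJ k0 Xk').
    apply: (failure_le ng0 nN (half_pow_le R ng0)).
    apply: (excess_probability_le ng0 c0 (phase_rate_ge0 R G) (phase_rate R n16 D1 reg) D3 l1).
    + exact: up_log3_le.
    + by move: la; rewrite /a; lra.
    + by lra.
    + by move: X2; rewrite /u mulrA ler_pdivrMr.
  rewrite [189 * _]mulrC -mulrA ler_wpM2l //.
  have := up_log_up_log_le l1 l2; rewrite -/M -/J -/u; lra.
Qed.
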